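(* Let $m\geq 3$. For any nonzero real number $k$, there does not exist any real hypersurface $M$ in $\mathbb{C}P^m$ such that $A_T^{(k)}$ is $\eta$-pure with respect to $\phi$, that is, such that $A_T^{(k)}(\phi X,Y)=A_T^{(k)}(X,\phi Y)$ for any $X,Y\in\mathbb{D}$.
   Context: $\mathbb{C}P^m$ is complex projective space with its Kaehlerian structure $(J,g)$, where $g$ is the Fubini-Study metric of constant holomorphic sectional curvature $4$. All manifolds, vector fields, etc. are of class $C^\infty$. A real hypersurface $M$ is connected and without boundary; $g$ also denotes the induced metric on $M$ and $\nabla$ the Levi-Civita connection of $M$. $N$ is a locally defined unit normal vector field on $M$, $A$ is the shape operator of $M$ associated to $N$ (so $AX=-\overline{\nabla}_XN$, with $\overline{\nabla}$ the Levi-Civita connection of $\mathbb{C}P^m$), and $\xi=-JN$ is the structure (Reeb) vector field. For $X$ tangent to $M$ write $JX=\phi X+\eta(X)N$, where $\phi X$ is the tangential component of $JX$ and $\eta(X)=g(X,\xi)$; $\phi$ is called the structure tensor. $\mathbb{D}$ is the maximal holomorphic distribution on $M$, consisting at each point of the tangent vectors orthogonal to $\xi$. For a nonzero real number $k$ and $X,Y$ tangent to $M$, set $F^{(k)}_XY=g(\phi AX,Y)\xi-\eta(Y)\phi AX-k\eta(X)\phi Y$ (the $k$-th Cho operator) and $T^{(k)}_XY=F^{(k)}_XY-F^{(k)}_YX$ (the $k$-th torsion operator). For $X,Y$ tangent to $M$, $A_T^{(k)}(X,Y)=[T^{(k)}_X,A]Y=T^{(k)}_XAY-AT^{(k)}_XY$.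 *)

(* Defs.v *)
From HB Require Import structures.
From mathcomp Require Import all_boot all_order all_algebra.
From mathcomp Require Import complex.
From mathcomp Require Import boolp classical_sets functions reals topology.
From mathcomp Require Import normedtype derive.

Set Implicit Arguments.
Unset Strict Implicit.
Unset Printing Implicit Defensive.

Import Order.TTheory GRing.Theory Num.Theory.
Import numFieldNormedType.Exports.

Local Open Scope classical_set_scope.
Local Open Scope ring_scope.
Local Open Scope complex_scope.

(* Vectors are row vectors, so the differential of [f] at [u] is
   [v |-> v *m 'J f u], and the image of the differential is the row space of
   the matrix ['J f u]. *)

Section Smooth.
Variables (R : realType) (n p : nat).

(* C^infty on an open set [V]: [f] and all its iterated directional
   derivatives are differentiable at every point of [V]. *)
Definition smooth_on (V : set 'rV[R]_n) (f : 'rV[R]_n -> 'rV[R]_p) : Prop :=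
  forall s : seq 'rV[R]_n, forall u, V u ->
    differentiable (foldr (fun v g => fun x => 'D_v g x) f s) u.

End Smooth.

Section Manifold.
Variables (R : realType) (n : nat).

(* [param] is the inverse of [coord]; its values outside the open set
   [coord @` dom] are irrelevant. *)
Record chart (T : topologicalType) := Chart {
  dom : set T;
  coord : T -> 'rV[R]_n;
  param : 'rV[R]_n -> T;
  dom_open : open dom;
  codom_open : open (coord @` dom);
  coordK : forall x, dom x -> param (coord x) = x;
  coord_continuous : forall x, dom x -> {for x, continuous coord};
  param_continuous : forall u, (coord @` dom) u -> {for u, continuous param}
}.

Record smooth_manifold := SmoothManifold {
  carrier :> topologicalType;
  manifold_hausdorff : hausdorff_space carrier;
  manifold_countable : @second_countable carrier;
  atlas : set (chart carrier);
  atlas_cover : forall x : carrier, exists2 c, atlas c & dom c x;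
  atlas_smooth : forall c d, atlas c -> atlas d ->
    smooth_on (coord c @` (dom c `&` dom d)) (coord d \o param c)
}.

End Manifold.

Section Metric.
Variables (R : realType) (n : nat).

(* A metric on (an open set of) R^n: [G z v w] is the inner product at [z] of
   the tangent vectors [v] and [w]. *)
Variable G : 'rV[R]_n -> 'rV[R]_n -> 'rV[R]_n -> R.

Let e (j : 'I_n) : 'rV[R]_n := delta_mx 0 j.

Definition gram (z : 'rV[R]_n) : 'M[R]_n := \matrix_(i, j) G z (e i) (e j).

(* The vector Gamma_z(v, w) = sum_(i,j,l) v_i w_j Gamma^l_(ij)(z) e_l, whose
   lowered components are given by the Koszul formula. *)
Definition christoffel (z v w : 'rV[R]_n) : 'rV[R]_n :=
  (\row_j (2^-1 * ('D_v (fun y => G y w (e j)) z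
                 + 'D_w (fun y => G y v (e j)) z
                 - 'D_(e j) (fun y => G y v w) z))) *m invmx (gram z).

(* Levi-Civita derivative, in the direction [v] at the point [u], of the vector
   field [W] along the map [h]. *)
Definition covd (q : nat) (h W : 'rV[R]_q -> 'rV[R]_n) (u v : 'rV[R]_q) :
    'rV[R]_n :=
  'D_v W u + christoffel (h u) ('D_v h u) (W u).

End Metric.

Section ProjectiveSpace.
Variables (R : realType) (m : nat).

(* The complex lines of C^(m+1). *)
Definition CP : Type := {L : {vspace 'rV[R[i]]_m.+1} | \dim L == 1%N}.

(* Homogeneous coordinates of a point; only notions invariant under rescaling
   are derived from them. *)
Definition homog (L : CP) : 'rV[R[i]]_m.+1 := vpick (sval L).

(* C^m is identified with R^(2m) by z |-> (Re z, Im z). *)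
Definition realify (z : 'rV[R[i]]_m) : 'rV[R]_(m + m) :=
  row_mx (map_mx (@complex.Re R) z) (map_mx (@complex.Im R) z).

Definition complexify (v : 'rV[R]_(m + m)) : 'rV[R[i]]_m :=
  \row_j (lsubmx v 0 j +i* rsubmx v 0 j).

Definition aff_dom (i : 'I_m.+1) : set CP := [set L | homog L 0 i != 0].

Definition aff (i : 'I_m.+1) (L : CP) : 'rV[R]_(m + m) :=
  realify (\row_j (homog L 0 (lift i j) / homog L 0 i)).

Definition J (v : 'rV[R]_(m + m)) : 'rV[R]_(m + m) :=
  realify ('i%C *: complexify v).

Definition herm (v w : 'rV[R[i]]_m) : R[i] := \sum_j v 0 j * (w 0 j)^*%C.

(* The Fubini-Study metric of constant holomorphic sectional curvature 4; its
   expression is the same in all the affine charts. For m = 1 it is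
   |dz|^2 / (1 + |z|^2)^2, the round metric of curvature 4. *)
Definition fubini_study (z v w : 'rV[R]_(m + m)) : R :=
  let z' := complexify z in
  let v' := complexify v in
  let w' := complexify w in
  complex.Re (((1 + herm z' z') * herm v' w' - herm v' z' * herm z' w')
              / (1 + herm z' z') ^+ 2).

End ProjectiveSpace.

Section Hypersurface.
Variables (R : realType) (m : nat).

Definition local_map (M : smooth_manifold R (m + m).-1) (f : M -> CP R m)
    (c : chart R (m + m).-1 M) (i : 'I_m.+1) :
    'rV[R]_((m + m).-1) -> 'rV[R]_(m + m) :=
  fun u => aff i (f (param c u)).

Definition local_dom (M : smooth_manifold R (m + m).-1) (f : M -> CP R m)
    (c : chart R (m + m).-1 M) (i : 'I_m.+1) : set 'rV[R]_((m + m).-1) :=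
  coord c @` (dom c `&` f @^-1` @aff_dom R m i).

(* A connected manifold of real dimension 2m-1 immersed in CP^m. *)
Record real_hypersurface := RealHypersurface {
  hs_manifold :> smooth_manifold R (m + m).-1;
  hs_nonempty : [set: hs_manifold] !=set0;
  hs_connected : connected [set: hs_manifold];
  hs_map : hs_manifold -> CP R m;
  hs_open : forall i, open (hs_map @^-1` @aff_dom R m i);
  hs_smooth : forall c i, atlas c ->
    smooth_on (local_dom hs_map c i) (local_map hs_map c i);
  hs_immersion : forall c i, atlas c ->
    forall u, local_dom hs_map c i u -> row_free ('J (local_map hs_map c i) u)
}.

End Hypersurface.

Section LocalGeometry.
Variables (R : realType) (m : nat) (k : R).

(* [h] is a local expression of the immersion and [N] that of a unit normal
   field; tangent vectors of the hypersurface are identified with their images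
   under the differential of [h]. *)
Variables h N : 'rV[R]_((m + m).-1) -> 'rV[R]_(m + m).

Definition tangent (u : 'rV[R]_((m + m).-1)) (X : 'rV[R]_(m + m)) : Prop :=
  (X <= 'J h u)%MS.

Definition unit_normal_on (V : set 'rV[R]_((m + m).-1)) : Prop :=
  smooth_on V N /\
  forall u, V u ->
    fubini_study (h u) (N u) (N u) = 1 /\
    forall X, tangent u X -> fubini_study (h u) X (N u) = 0.

Variable u : 'rV[R]_((m + m).-1).

Let g (X Y : 'rV[R]_(m + m)) : R := fubini_study (h u) X Y.

(* For [X] tangent, [X *m pinvmx ('J h u)] is the vector mapped to [X] by the
   differential of [h], which is injective. *)
Definition shape (X : 'rV[R]_(m + m)) : 'rV[R]_(m + m) :=
  - covd (@fubini_study R m) h N u (X *m pinvmx ('J h u)).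

Definition xi : 'rV[R]_(m + m) := - J (N u).

Definition eta (X : 'rV[R]_(m + m)) : R := g X xi.

Definition phi (X : 'rV[R]_(m + m)) : 'rV[R]_(m + m) :=
  J X - g (J X) (N u) *: N u.

Definition max_holomorphic (X : 'rV[R]_(m + m)) : Prop :=
  tangent u X /\ g X xi = 0.

Definition cho (X Y : 'rV[R]_(m + m)) : 'rV[R]_(m + m) :=
  g (phi (shape X)) Y *: xi - eta Y *: phi (shape X) - (k * eta X) *: phi Y.

Definition torsion (X Y : 'rV[R]_(m + m)) : 'rV[R]_(m + m) :=
  cho X Y - cho Y X.

Definition shape_torsion (X Y : 'rV[R]_(m + m)) : 'rV[R]_(m + m) :=
  torsion X (shape Y) - shape (torsion X Y).

End LocalGeometry.

(* The condition is sensitive to the sign of [N] (changing it amounts to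
   changing the sign of [k]); it is required for some smooth choice of the unit
   normal in a neighbourhood [V] of each point. *)
Definition eta_pure (R : realType) (m : nat) (k : R)
    (M : real_hypersurface R m) : Prop :=
  forall x : M, exists (c : chart R (m + m).-1 M) (i : 'I_m.+1)
      (V : set 'rV[R]_((m + m).-1))
      (N : 'rV[R]_((m + m).-1) -> 'rV[R]_(m + m)),
    let h := local_map (@hs_map R m M) c i in
    [/\ atlas c, dom c x, open V, V (coord c x) &
        V `<=` local_dom (@hs_map R m M) c i] /\
    unit_normal_on h N V /\
    (forall u, V u -> forall X Y : 'rV[R]_(m + m),
       max_holomorphic h N u X -> max_holomorphic h N u Y ->
       shape_torsion k h N u (phi h N u X) Y =
       shape_torsion k h N u X (phi h N u Y)).

(* Main.v *)
Require Import Defs.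
From HB Require Import structures.
From mathcomp Require Import all_boot all_order all_algebra.
From mathcomp Require Import complex ring lra.
From mathcomp Require Import boolp classical_sets functions reals topology.
From mathcomp Require Import normedtype landau derive.

Set Implicit Arguments.
Unset Strict Implicit.
Unset Printing Implicit Defensive.

Import Order.TTheory GRing.Theory Num.Theory.
Import numFieldNormedType.Exports.

Local Open Scope classical_set_scope.
Local Open Scope ring_scope.

(* Where [A xi] has a nonzero horizontal part [b], the components of the purity
   condition along [b], for horizontal [X] orthogonal to [b] and [phi b], give
   [g (A X) X = g (A (phi X)) (phi X) = k |X|^2] and
   [g (A X) X + g (A (phi X)) (phi X) = 0], so [k = 0].  Hence [A xi = alpha xi]
   everywhere, and the [xi]-component of purity reads
   [S^2 = 2 alpha S] with [S = A - phi A phi], while the Codazzi equation gives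
   [2 A phi A - alpha (phi A + A phi) = 2 phi].  Together they say that the
   symmetric operator [A + phi A phi] has square [-4], which is absurd.

   The Codazzi equation is only needed for the one-form
   [theta = g (A xi, .) = g (J N, nabla N)], whose exterior derivative is
   computed directly from the curvature of the Fubini-Study metric; its
   Levi-Civita connection is complex bilinear in an affine chart. *)

(* [dot], [imul] and [fs] are sealed because unification otherwise computes
   with matrices whenever two vectors fail to match; so are [nabla] and
   [weingarten] below. *)
HB.lock Definition dot (R : realFieldType) (n : nat) (v w : 'rV[R]_n) : R :=
  \sum_j v 0 j * w 0 j.

HB.lock Definition imul (R : realType) (m : nat) (v : 'rV[R]_(m + m)) :
  'rV[R]_(m + m) := J v.

HB.lock Definition fs (R : realType) (m : nat) (z v w : 'rV[R]_(m + m)) : R :=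
  fubini_study z v w.

Arguments dot {R n} v w.
Arguments imul {R m} v.
Arguments fs {R m} z v w.

(** * The real inner product on row vectors *)

Section Dot.
Variables (R : realFieldType) (n : nat).
Implicit Types v w x : 'rV[R]_n.

Lemma dotE v w : dot v w = \sum_j v 0 j * w 0 j.
Proof. by rewrite dot.unlock. Qed.

Lemma dotC v w : dot v w = dot w v.
Proof. by rewrite !dotE; apply: eq_bigr => j _; rewrite mulrC. Qed.

Lemma dotDl v w x : dot (v + w) x = dot v x + dot w x.
Proof.
by rewrite !dotE -big_split; apply: eq_bigr => j _; rewrite mxE mulrDl.
Qed.

Lemma dotZl a v w : dot (a *: v) w = a * dot v w.
Proof.
by rewrite !dotE mulr_sumr; apply: eq_bigr => j _; rewrite mxE mulrA.
Qed.

Lemma dotDr x v w : dot x (v + w) = dot x v + dot x w.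
Proof. by rewrite dotC dotDl !(dotC x). Qed.

Lemma dotZr a v w : dot v (a *: w) = a * dot v w.
Proof. by rewrite dotC dotZl dotC. Qed.

Lemma dotNl v w : dot (- v) w = - dot v w.
Proof. by rewrite -scaleN1r dotZl mulN1r. Qed.

Lemma dotNr v w : dot v (- w) = - dot v w.
Proof. by rewrite dotC dotNl dotC. Qed.

Lemma dot_ge0 v : 0 <= dot v v.
Proof. by rewrite dotE; apply: sumr_ge0 => j _; rewrite -expr2 sqr_ge0. Qed.

Lemma dot_eq0 v : (dot v v == 0) = (v == 0).
Proof.
rewrite dotE psumr_eq0; last by move=> j _; rewrite -expr2 sqr_ge0.
apply/allP/eqP => [h|-> j _]; last by rewrite mxE mul0r eqxx.
by apply/rowP => j; have := h j (mem_index_enum j);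
  rewrite mxE -expr2 sqrf_eq0 => /eqP.
Qed.

End Dot.

(** * The complex structure and the metric in real coordinates *)

Section ComplexStructure.
Variables (R : realType) (m : nat).
Implicit Types v w x z : 'rV[R]_(m + m).

Lemma imulE v : imul v = row_mx (- rsubmx v) (lsubmx v).
Proof.
rewrite imul.unlock /J /realify; congr row_mx; apply/rowP => j; rewrite !mxE /=.
  by rewrite mul0r mul1r add0r.
by rewrite mul0r mul1r add0r.
Qed.

Lemma imul_is_linear : linear (@imul R m).
Proof.
by move=> a v w; rewrite !imulE !linearP scale_row_mx add_row_mx.
Qed.

HB.instance Definition _ :=
  GRing.isLinear.Build R 'rV[R]_(m + m) 'rV[R]_(m + m) *:%R (@imul R m)
    imul_is_linear.

Lemma imulD v w : imul (v + w) = imul v + imul w.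
Proof. exact: linearD. Qed.

Lemma imulZ a v : imul (a *: v) = a *: imul v.
Proof. exact: linearZ. Qed.

Lemma imulN v : imul (- v) = - imul v.
Proof. exact: linearN. Qed.

Lemma imul_imul v : imul (imul v) = - v.
Proof. by rewrite !imulE row_mxKl row_mxKr -opp_row_mx hsubmxK. Qed.

Lemma dot_split v w :
  dot v w = dot (lsubmx v) (lsubmx w) + dot (rsubmx v) (rsubmx w).
Proof.
rewrite !dotE big_split_ord /=.
by congr (_ + _); apply: eq_bigr => j _; rewrite !mxE.
Qed.

Lemma dot_imul v w : dot (imul v) (imul w) = dot v w.
Proof.
by rewrite !dot_split !imulE !row_mxKl !row_mxKr dotNl dotNr opprK addrC.
Qed.

Lemma dot_imull v w : dot (imul v) w = - dot v (imul w).
Proof. by rewrite -[w in LHS]opprK -imul_imul dot_imul linearN dotNr. Qed.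

Lemma dot_imulid v : dot v (imul v) = 0.
Proof. by have := dot_imull v v; rewrite dotC; lra. Qed.

Lemma herm_complexify v w :
  herm (complexify v) (complexify w) = Complex (dot v w) (dot v (imul w)).
Proof.
rewrite /herm.
have -> : \sum_j complexify v 0 j * ((complexify w 0 j)^*)%C =
  \sum_j Complex (v 0 (lshift m j) * w 0 (lshift m j)
                 + v 0 (rshift m j) * w 0 (rshift m j))
            (v 0 (rshift m j) * w 0 (lshift m j)
                 - v 0 (lshift m j) * w 0 (rshift m j)).
  by apply: eq_bigr => j _; rewrite !mxE; congr Complex => /=; ring.
rewrite (_ : \sum_j _ = Complex (\sum_j (v 0 (lshift m j) * w 0 (lshift m j)
                 + v 0 (rshift m j) * w 0 (rshift m j)))
            (\sum_j (v 0 (rshift m j) * w 0 (lshift m j)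
                 - v 0 (lshift m j) * w 0 (rshift m j)))); last first.
  by elim/big_rec3: _ => // j a b c _ ->.
congr Complex; rewrite !dotE big_split_ord /= big_split //=.
rewrite addrC; congr (_ + _); apply: eq_bigr => j _; rewrite imulE.
  by rewrite row_mxEl !mxE; ring.
by rewrite row_mxEr !mxE.
Qed.

(** [dot v z] and [dot v (imul z)] are the real and imaginary parts of the Hermitian product of [v]
    and [z]; the denominator is real because [dot z (imul z)] vanishes. *)
Lemma fsE z v w : fs z v w =
  (1 + dot z z)^-1 * dot v w
  - (1 + dot z z) ^- 2 * (dot v z * dot w z + dot v (imul z) * dot w (imul z)).
Proof.
rewrite fs.unlock /fubini_study !herm_complexify dot_imulid.
have nz : 1 + dot z z != 0 by have := dot_ge0 z; lra.
have -> : (1 + Complex (dot z z) 0)%R = Complex (1 + dot z z) 0.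
  by apply/eqP; rewrite eq_complex /= addr0 !eqxx.
have -> : Complex (1 + dot z z) 0 ^+ 2 = Complex ((1 + dot z z) ^+ 2) 0.
  by apply/eqP; rewrite eq_complex /= !expr2 !mulr0 !mul0r subr0 addr0 !eqxx.
rewrite (dotC z) -[dot z (imul w)]opprK -dot_imull (dotC (imul z)) /=.
rewrite !(mul0r, oppr0, mulr0, addr0, subr0, expr0n) /=.
by field.
Qed.

End ComplexStructure.

(** * Rules for directional derivatives *)

Lemma is_derive_near_cst (R : realType) (V : normedModType R) (x v : V)
    (f : V -> R) (c df : R) :
  is_derive x v f df -> (\forall y \near x, f y = c) -> df = 0.
Proof.
move=> [_ <-] fc; rewrite -(derive_cst c x v).
exact: (near_eq_derive (g := cst c)) fc.
Qed.

(** At a common zero of [f] and [g] the product rule loses the terms in [dp] and [dq], so only the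
    derivatives of [f] and [g] survive. *)
Lemma derive_proportional (R : realType) (V : normedModType R) (x v : V)
    (f g p q : V -> R) (df dg dp dq : R) :
  is_derive x v f df -> is_derive x v g dg ->
  is_derive x v p dp -> is_derive x v q dq ->
  (\forall y \near x, f y * q y = p y * g y) -> f x = 0 -> g x = 0 ->
  df * q x = p x * dg.
Proof.
move=> hf hg hp hq fg f0 g0.
have D := is_deriveB (is_deriveM hf hq) (is_deriveM hp hg).
have D0 : \forall y \near x, (f * q - p * g) y = 0.
  by apply: filterS fg => y E; rewrite !fctE E subrr.
have := is_derive_near_cst D D0; rewrite f0 g0 !scale0r add0r addr0 => /eqP.
by rewrite subr_eq0 mulrC => /eqP.
Qed.

Section DeriveRow.
Variables (R : realType) (V : normedModType R) (n : nat).
Implicit Types (x v : V) (F G : V -> 'rV[R]_n).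

Lemma is_derive_rowP x v F dF :
  is_derive x v F dF <->
  (forall j, is_derive x v (fun y => F y 0 j) (dF 0 j)).
Proof.
split=> [[derF <-] j|h].
  apply: DeriveDef; first by have /derivable_mxP := derF; exact.
  by rewrite derive_mx // mxE.
have derF : derivable F x v.
  by apply/derivable_mxP => i j; rewrite (ord1 i); have [] := h j.
apply: DeriveDef => //; rewrite derive_mx //; apply/rowP => j.
by rewrite mxE; have [_] := h j.
Qed.

Lemma is_derive_dot x v F G dF dG :
  is_derive x v F dF -> is_derive x v G dG ->
  is_derive x v (fun y => dot (F y) (G y)) (dot dF (G x) + dot (F x) dG).
Proof.
move=> /is_derive_rowP hF /is_derive_rowP hG.
pose P j (y : V) := F y 0 j * G y 0 j.
have hP j : is_derive x v (P j) (F x 0 j *: dG 0 j + G x 0 j *: dF 0 j).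
  by have := @is_deriveM _ _ _ _ x v _ _ (hF j) (hG j).
have := @is_derive_sum _ _ _ _ P x v _ hP.
rewrite (_ : \sum_(i < n) P i = (fun y => dot (F y) (G y))); last first.
  by apply/funext => y; rewrite /P fct_sumE dotE.
move=> h; apply: is_derive_eq h _.
rewrite !dotE big_split addrC /=; congr (_ + _).
by apply: eq_bigr => j _; rewrite mulrC.
Qed.

Lemma is_derive_scale x v (a : V -> R) F da dF :
  is_derive x v a da -> is_derive x v F dF ->
  is_derive x v (fun y => a y *: F y) (da *: F x + a x *: dF).
Proof.
move=> ha /is_derive_rowP hF; apply/is_derive_rowP => j.
rewrite (_ : (fun y => _) = a * (fun y => F y 0 j)); last first.
  by apply/funext => y; rewrite !mxE.
have h := is_deriveM ha (hF j).
by apply: is_derive_eq h _; rewrite !mxE addrC; congr (_ + _); rewrite mulrC.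
Qed.

Lemma is_deriveVr x v (a : V -> R) da : a x != 0 ->
  is_derive x v a da ->
  is_derive x v (fun y => (a y)^-1) (- (a x) ^- 2 * da).
Proof.
move=> a0 [dera <-]; apply: DeriveDef; first exact: derivableV.
by rewrite deriveV.
Qed.

End DeriveRow.

Lemma is_derive_imul (R : realType) (V : normedModType R) (m : nat) (x v : V)
    (F : V -> 'rV[R]_(m + m)) dF :
  is_derive x v F dF -> is_derive x v (fun y => imul (F y)) (imul dF).
Proof.
move=> hF; apply/is_derive_rowP => j.
(* Each coordinate of [imul w] is the inner product of [w] with a fixed vector, so [is_derive_dot]
   applies. *)
have coord (w : 'rV[R]_(m + m)) : imul w 0 j = dot w (- imul (delta_mx 0 j)).
  rewrite dotNr -dot_imull dotE (bigD1 j) //= big1 ?addr0.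
    by rewrite [delta_mx _ _ _ _]mxE !eqxx mulr1.
  by move=> i /negPf ij; rewrite [delta_mx _ _ _ _]mxE ij andbF mulr0.
rewrite (_ : (fun y => _) = (fun y => dot (F y) (- imul (delta_mx 0 j)))).
  have := is_derive_dot hF (is_derive_cst (- imul (delta_mx 0 j)) x v).
  move=> h; apply: is_derive_eq h _.
  rewrite coord (_ : dot (F x) 0 = 0) ?addr0 //.
  by rewrite -(scale0r (0 : 'rV[R]_(m + m))) dotZr mul0r.
by apply/funext => y; rewrite coord.
Qed.

(** * Symmetry of second derivatives *)

Section Schwarz.
Variables (R : realType) (V : normedModType R).
Implicit Types (f : V -> R) (u v w : V).

Lemma is_derive_line f u v (s : R) :
  differentiable f (u + s *: v) ->
  is_derive s 1 (fun t => f (u + t *: v)) ('D_v f (u + s *: v)).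
Proof.
move=> df.
have E : (fun h : R => h^-1 *: (((fun t => f (u + t *: v)) \o shift s) (h *: 1)
                                - f (u + s *: v))) =
         (fun h : R => h^-1 *: ((f \o shift (u + s *: v)) (h *: v)
                                - f (u + s *: v))).
  apply/funext => h /=; congr (_ *: (f _ - _)).
  by rewrite scalerDl addrCA [h *: 1]mulr1.
by apply: DeriveDef; rewrite /derivable /derive E //; exact: diff_derivable df.
Qed.

(* The mean value theorem for [s |-> f (u + s v + t w) - f (u + s v)]. *)
Lemma second_difference f u v w (t : R) : 0 < t ->
  (forall s r, 0 <= s <= t -> 0 <= r <= t ->
    differentiable f (u + s *: v + r *: w)) ->
  exists2 s, 0 <= s <= t &
    f (u + t *: v + t *: w) - f (u + t *: v) - f (u + t *: w) + f u =
    ('D_v f (u + s *: v + t *: w) - 'D_v f (u + s *: v)) * t.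
Proof.
move=> t0 df.
pose F s := f (u + t *: w + s *: v) - f (u + s *: v).
have dF s : 0 <= s <= t ->
    is_derive s 1 F ('D_v f (u + s *: v + t *: w) - 'D_v f (u + s *: v)).
  move=> st.
  have h1 : is_derive s 1 (fun s => f (u + t *: w + s *: v))
      ('D_v f (u + s *: v + t *: w)).
    rewrite addrAC; apply: is_derive_line; rewrite addrAC.
    by apply: df => //; rewrite lexx ltW.
  have h2 : is_derive s 1 (fun s => f (u + s *: v)) ('D_v f (u + s *: v)).
    by apply: is_derive_line; have := df s 0 st; rewrite scale0r addr0; apply;
      rewrite lexx ltW.
  exact: is_deriveB h1 h2.
have dF' s : s \in `]0, t[ ->
    is_derive s 1 F ('D_v f (u + s *: v + t *: w) - 'D_v f (u + s *: v)).
  by rewrite in_itv => /andP[s0 st]; apply: dF; rewrite !ltW.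
have cF : {within `[0, t], continuous F}.
  apply: derivable_within_continuous => s; rewrite in_itv => st.
  by have [] := dF s st.
have [c] := MVT t0 dF' cF.
rewrite in_itv /= => /andP[c0 ct] E; exists c; first by rewrite !ltW.
move: E; rewrite subr0 /F scale0r !addr0 => <-.
by rewrite (addrAC u); ring.
Qed.

Lemma diff_approx f u (e : R) : differentiable f u -> 0 < e ->
  exists2 d, 0 < d & forall x : V, `|x| < d ->
    `|f (u + x) - f u - 'D_x f u| <= e * `|x|.
Proof.
move=> df e0.
have /eqaddoP := funext (diff_locallyxC df).
move=> /(_ _ e0) /nbhs_ballP[d /= d0 hd]; exists d => // x xd.
rewrite deriveE //.
have := hd x; rewrite -ball_normE /ball_ /= sub0r normrN => /(_ xd).
by rewrite opprD addrA.
Qed.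

(** The mean value theorem turns the second difference into [t] times an increment of [F], and [F]
    is then expanded to first order about [u] at both ends of that increment. *)
Lemma second_difference_approx f F u v w (e : R) :
  (\forall y \near u, differentiable f y /\ 'D_v f y = F y) ->
  differentiable F u ->
  0 < e ->
  exists2 d, 0 < d & forall t : R, 0 < t < d ->
    `|f (u + t *: v + t *: w) - f (u + t *: v) - f (u + t *: w) + f u
      - t ^+ 2 * 'D_w F u| <= e * (2 * (`|v| + `|w|)) * t ^+ 2.
Proof.
move=> /nbhs_ballP[d1 /= d10 df] dvf e0.
have [d2 d20 hG] := diff_approx dvf e0.
(* The summand 1 keeps the divisor positive when [v] and [w] both vanish. *)
pose K := `|v| + `|w| + 1.
have K0 : 0 < K by rewrite ltr_wpDl // addr_ge0.
exists (Num.min d1 d2 / K); first by rewrite divr_gt0 // lt_min d10.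
move=> t /andP[t0]; rewrite ltr_pdivlMr // lt_min => /andP[td1 td2].
have bound s r : 0 <= s <= t -> 0 <= r <= t ->
    `|s *: v + r *: w| <= t * (`|v| + `|w|).
  move=> /andP[s0 st] /andP[r0 rt].
  rewrite (le_trans (ler_normD _ _)) // !normrZ !ger0_norm // mulrDr.
  by rewrite lerD // ler_wpM2r.
have tK : t * (`|v| + `|w|) <= t * K by rewrite ler_pM2l // lerDl.
have tt : 0 <= t <= t by rewrite lexx ltW.
have zt : 0 <= (0 : R) <= t by rewrite lexx ltW.
have near_u s r : 0 <= s <= t -> 0 <= r <= t ->
    ball u d1 (u + s *: v + r *: w).
  move=> s0 r0; rewrite -ball_normE /ball_ /= -addrA opprD addNKr normrN.
  exact: le_lt_trans (le_trans (bound _ _ s0 r0) tK) td1.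
have [s r s0 r0|s s0 ->] := @second_difference f u v w t t0.
  by have [] := df _ (near_u _ _ s0 r0).
have [_ ->] := df _ (near_u _ _ s0 tt).
have [_] := df _ (near_u _ _ s0 zt); rewrite scale0r addr0 => ->.
have h1 := hG _ (le_lt_trans (le_trans (bound _ _ s0 tt) tK) td2).
have h2 := hG _ (le_lt_trans (le_trans (bound _ _ s0 zt) tK) td2).
have {h1} := le_trans h1 (ler_wpM2l (ltW e0) (bound _ _ s0 tt)).
have {h2} := le_trans h2 (ler_wpM2l (ltW e0) (bound _ _ s0 zt)).
have dG r : 'D_(s *: v + r *: w) F u = s * 'D_v F u + r * 'D_w F u.
  have dE x : 'D_x F u = 'd F u x by rewrite deriveE.
  by rewrite !dE linearD !linearZ.
rewrite !dG scale0r mul0r !addr0 (addrA u).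
set a := F (u + s *: v); set b := F (_ + _ + _); set c := F u.
set d := 'D_v F u; set d' := 'D_w F u.
move=> h2 h1.
(* The terms [s * d] of the two expansions cancel, so the unknown intermediate [s] leaves no trace
   in the main term. *)
rewrite (_ : (b - a) * t - _ =
  t * ((b - c - (s * d + t * d')) - (a - c - s * d))); last by ring.
rewrite normrM gtr0_norm //.
rewrite expr2 [leRHS]mulrCA mulrA [leRHS]mulrAC -[leRHS]mulrA.
rewrite ler_pM2l // (le_trans (ler_normB _ _)) //.
rewrite (le_trans (lerD h1 h2)) // le_eqVlt.
by apply/orP; left; apply/eqP; ring.
Qed.

(** The second difference is symmetric in [v] and [w]; divided by [t ^+ 2] it approximates both
    mixed derivatives. *)
Lemma derive_swap f F G u v w :
  (\forall y \near u,
    [/\ differentiable f y, 'D_v f y = F y & 'D_w f y = G y]) ->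
  differentiable F u -> differentiable G u -> 'D_w F u = 'D_v G u.
Proof.
move=> df dvf dwf; apply/eqP; rewrite -subr_eq0 -normr_le0.
apply/ler_addgt0Pl => e e0; rewrite addr0.
set a := 'D_w _ u; set b := 'D_v _ u.
have df1 : \forall y \near u, differentiable f y /\ 'D_v f y = F y.
  by apply: filterS df => y [].
have df2 : \forall y \near u, differentiable f y /\ 'D_w f y = G y.
  by apply: filterS df => y [].
(* Two approximations with tolerance [e / K] have total error [e / K] times [4 (|v| + |w|) t^2],
   which is at most [e t^2]. *)
pose K := 4 * (`|v| + `|w|) + 1.
have K0 : 0 < K by rewrite ltr_wpDl // mulr_ge0 // addr_ge0.
have eK : 0 < e / K by rewrite divr_gt0.
have [d1 d10 h1] := second_difference_approx w df1 dvf eK.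
have [d2 d20 h2] := second_difference_approx v df2 dwf eK.
pose t := Num.min d1 d2 / 2.
have t0 : 0 < t by rewrite divr_gt0 // lt_min d10.
have m12 : 0 < Num.min d1 d2 by rewrite lt_min d10.
have td1 : 0 < t < d1.
  rewrite t0 /= (lt_le_trans (y := Num.min d1 d2)) ?ge_min ?lexx //.
  by rewrite /t; lra.
have td2 : 0 < t < d2.
  rewrite t0 /= (lt_le_trans (y := Num.min d1 d2)) ?ge_min ?lexx ?orbT //.
  by rewrite /t; lra.
have t20 : 0 < t ^+ 2 by rewrite exprn_gt0.
rewrite -(ler_pM2l t20) -{1}(gtr0_norm t20) -normrM.
have := lerD (h2 t td2) (h1 t td1).
rewrite -/a -/b (addrAC u).
set p := f _; set q := f _; set r := f _; set z := f u.
move=> h; have := le_trans (ler_normB _ _) h.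
rewrite (_ : _ - (_ : R) = t ^+ 2 * (a - b)); last by ring.
move/le_trans; apply.
rewrite (_ : _ + _ = t ^+ 2 * (e / K * (4 * (`|v| + `|w|)))); last by ring.
rewrite ler_pM2l // mulrAC ler_pdivrMr // ler_pM2l // /K.
by rewrite lerDl.
Qed.

End Schwarz.

(** * The Fubini-Study metric and its connection *)

Section FubiniStudy.
Variables (R : realType) (m : nat).
Implicit Types v w x z : 'rV[R]_(m + m).

Lemma rho_gt0 z : 0 < 1 + dot z z.
Proof. by rewrite ltr_wpDr ?dot_ge0. Qed.

Lemma rho_neq0 z : 1 + dot z z != 0.
Proof. by rewrite gt_eqF ?rho_gt0. Qed.

Lemma fsC z v w : fs z v w = fs z w v.
Proof. by rewrite !fsE (dotC v w); congr (_ - _ * _); ring. Qed.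

Lemma fsDl z v w x :
  fs z (v + w) x = fs z v x + fs z w x.
Proof. by rewrite !fsE !dotDl; ring. Qed.

Lemma fsZl z a v w : fs z (a *: v) w = a * fs z v w.
Proof. by rewrite !fsE !dotZl; ring. Qed.

Lemma fsDr z v w x :
  fs z x (v + w) = fs z x v + fs z x w.
Proof. by rewrite fsC fsDl !(fsC z x). Qed.

Lemma fsZr z a v w : fs z v (a *: w) = a * fs z v w.
Proof. by rewrite fsC fsZl fsC. Qed.

Lemma fsNl z v w : fs z (- v) w = - fs z v w.
Proof. by rewrite -scaleN1r fsZl mulN1r. Qed.

Lemma fsNr z v w : fs z v (- w) = - fs z v w.
Proof. by rewrite fsC fsNl fsC. Qed.

Lemma fs0l z w : fs z 0 w = 0.
Proof. by rewrite -(scale0r 0) fsZl mul0r. Qed.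

Lemma fs_imul z v w : fs z (imul v) (imul w) = fs z v w.
Proof.
by rewrite !fsE !dot_imul !(dot_imull _ z); ring.
Qed.

Lemma fs_imull z v w : fs z (imul v) w = - fs z v (imul w).
Proof. by rewrite -[w in LHS]opprK -imul_imul fs_imul linearN fsNr. Qed.

Lemma fs_imulid z v : fs z v (imul v) = 0.
Proof. by have := fs_imull z v v; rewrite fsC; lra. Qed.

(* The defect in the Cauchy-Schwarz inequality is the squared norm of the
   part of [v] orthogonal to the complex line of [z]. *)
Lemma dot_CauchySchwarz v z :
  dot v z ^+ 2 + dot v (imul z) ^+ 2 <= dot v v * dot z z.
Proof.
have [z0|z0] := eqVneq (dot z z) 0.
  move/eqP: (z0); rewrite dot_eq0 => /eqP ->.
  by rewrite linear0 -(scale0r 0) !dotZr !mul0r expr0n mulr0 addr0.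
have zp : 0 < dot z z by rewrite lt0r z0 dot_ge0.
have := dot_ge0 (dot z z *: v - dot v z *: z - dot v (imul z) *: imul z).
rewrite !(dotDl, dotDr, dotNl, dotNr, dotZl, dotZr) dot_imul.
rewrite !(dotC z v) (dotC (imul z) v) (dotC (imul z) z) dot_imulid => h.
rewrite -subr_ge0 -(pmulr_rge0 _ zp) (le_trans h) // le_eqVlt.
by apply/orP; left; apply/eqP; ring.
Qed.

(** The right-hand side is [(1 + |z|^2) |v|^2] minus the squared modulus of the Hermitian product of
    [v] and [z], which Cauchy-Schwarz bounds by [|v|^2 |z|^2]. Positive definiteness of the metric
    follows. *)
Lemma fs_ge_dot z v :
  dot v v <= (1 + dot z z) ^+ 2 * fs z v v.
Proof.
have -> : (1 + dot z z) ^+ 2 * fs z v v =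
    (1 + dot z z) * dot v v - (dot v z ^+ 2 + dot v (imul z) ^+ 2).
  by rewrite fsE; field; rewrite rho_neq0.
by have := dot_CauchySchwarz v z; lra.
Qed.

Lemma fs_ge0 z v : 0 <= fs z v v.
Proof.
have := le_trans (dot_ge0 v) (fs_ge_dot z v).
by rewrite pmulr_rge0 // exprn_gt0 // rho_gt0.
Qed.

Lemma fs_eq0 z v : fs z v v = 0 -> v = 0.
Proof.
move=> h; have := fs_ge_dot z v; rewrite h mulr0 => v0.
by apply/eqP; rewrite -dot_eq0 eq_le v0 dot_ge0.
Qed.

(* The complex-bilinear map -(<v, z> w + <w, z> v) / (1 + |z|^2). *)
Definition fs_gamma z v w : 'rV[R]_(m + m) :=
  - (1 + dot z z)^-1 *: (dot v z *: w + dot v (imul z) *: imul w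
                         + (dot w z *: v + dot w (imul z) *: imul v)).

Lemma fs_gammaC z v w : fs_gamma z v w = fs_gamma z w v.
Proof. by rewrite /fs_gamma (addrC (_ *: w + _)). Qed.

(** Complex linearity of the Christoffel map makes [imul] parallel: this is the Kaehler property. *)
Lemma fs_gamma_imul z v w : fs_gamma z v (imul w) = imul (fs_gamma z v w).
Proof.
rewrite /fs_gamma !(imulZ, imulD) !imul_imul dot_imull dot_imul.
by congr (_ *: _); apply/rowP => j; rewrite !mxE; ring.
Qed.

Lemma fs_gammaDl z v v' w :
  fs_gamma z (v + v') w = fs_gamma z v w + fs_gamma z v' w.
Proof.
rewrite /fs_gamma -scalerDr; congr (_ *: _).
by rewrite imulD !dotDl; apply/rowP => j; rewrite !mxE; ring.
Qed.

Lemma fs_gammaZl z a v w : fs_gamma z (a *: v) w = a *: fs_gamma z v w.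
Proof.
by rewrite /fs_gamma imulZ !dotZl; apply/rowP => j; rewrite !mxE; ring.
Qed.

Section MetricCompatibility.
Variables (V : normedModType R) (x v : V) (h P Q : V -> 'rV[R]_(m + m)).
Variables (dh dP dQ : 'rV[R]_(m + m)).
Hypotheses (hh : is_derive x v h dh) (hP : is_derive x v P dP)
  (hQ : is_derive x v Q dQ).

Lemma is_derive_rhoV : is_derive x v (fun y => (1 + dot (h y) (h y))^-1)
  (- (1 + dot (h x) (h x)) ^- 2 * (2 * dot dh (h x))).
Proof.
apply: is_deriveVr; first exact: rho_neq0.
have := is_deriveD (is_derive_cst (1 : R) x v) (is_derive_dot hh hh).
by move=> H; apply: is_derive_eq H _; rewrite (dotC (h x)); ring.
Qed.

(** The connection with coefficients [fs_gamma] is metric: after the product rule, both sides agree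
    as rational expressions in inner products. *)
Lemma is_derive_fs :
  is_derive x v (fun y => fs (h y) (P y) (Q y))
    (fs (h x) (dP + fs_gamma (h x) dh (P x)) (Q x)
     + fs (h x) (P x) (dQ + fs_gamma (h x) dh (Q x))).
Proof.
have hr := is_derive_rhoV.
have hJ := is_derive_imul hh.
have h1 := is_deriveM hr (is_derive_dot hP hQ).
have h2 := is_deriveD (is_deriveM (is_derive_dot hP hh) (is_derive_dot hQ hh))
  (is_deriveM (is_derive_dot hP hJ) (is_derive_dot hQ hJ)).
have h3 := is_deriveM (is_deriveM hr hr) h2.
have := is_deriveB h1 h3.
rewrite [F in is_derive _ _ F](_ : _ =
    fun y => fs (h y) (P y) (Q y)); last first.
  apply/funext => y; rewrite fsE; congr (_ - _ * _).
  by rewrite -exprVn expr2.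
move=> H; apply: is_derive_eq H _.
rewrite /fs_gamma.
rewrite !fsE !(dotDl, dotDr, dotZl, dotZr).
rewrite !(dot_imull, dotNl, dotNr, imul_imul).
set z := h x; set p := P x; set q := Q x.
rewrite (dotC dh q) (dotC dh (imul q)) dot_imull.
rewrite /GRing.scale /= !fctE -/z -/p -/q.
field; exact: rho_neq0.
Qed.
End MetricCompatibility.
End FubiniStudy.

(** * The Levi-Civita connection of the Fubini-Study metric *)

Section Christoffel.
Variables (R : realType) (m : nat).
Implicit Types v w x z : 'rV[R]_(m + m).

Lemma fs_suml z x w : fs z x w = \sum_i x 0 i * fs z (delta_mx 0 i) w.
Proof.
rewrite {1}(row_sum_delta x) (big_morph (fs z ^~ w) (fun a b => fsDl z a b w)
  (fs0l z w)).
by apply: eq_bigr => i _; rewrite fsZl.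
Qed.

Lemma mul_gramE z x j :
  (x *m gram (@fubini_study R m) z) 0 j = fs z x (delta_mx 0 j).
Proof.
by rewrite mxE fs_suml; apply: eq_bigr => i _; rewrite mxE fs.unlock.
Qed.

Lemma gram_fs_unit z : gram (@fubini_study R m) z \in unitmx.
Proof.
rewrite -row_free_unit; apply: inj_row_free => v v0; apply: (fs_eq0 (z := z)).
rewrite fs_suml big1 // => j _.
by rewrite fsC -mul_gramE v0 mxE mulr0.
Qed.

(** Since [fs_gamma] is symmetric and compatible with the metric, the Koszul formula collapses to
    the lowered components of [fs_gamma z v w], and the Gram matrix is invertible. *)
Lemma christoffel_fs z v w :
  christoffel (@fubini_study R m) z v w = fs_gamma z v w.
Proof.
rewrite /christoffel -[RHS](mulmxK (gram_fs_unit z)); congr (_ *m _).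
apply/rowP => j; rewrite mul_gramE mxE.
have D a b c : 'D_a (fun y => fubini_study y b c) z =
    fs z (fs_gamma z a b) c + fs z b (fs_gamma z a c).
  have := is_derive_fs (is_derive_id z a) (is_derive_cst b z a)
    (is_derive_cst c z a).
  rewrite !add0r; case=> _ <-; congr ('D_a _ z).
  by apply/funext => y; rewrite fs.unlock.
rewrite !D; set e := delta_mx 0 j.
rewrite (fs_gammaC z w v) (fs_gammaC z e v) (fs_gammaC z e w).
by rewrite (fsC z (fs_gamma z v e)); field.
Qed.

End Christoffel.

(** * Curvature of the Fubini-Study metric *)

Section Curvature.
Variables (R : realType) (m : nat).
Implicit Types v w x z : 'rV[R]_(m + m).

(* The derivative of [fs_gamma z v w] in [z] in the direction [d]. *)
Definition fs_dgamma z d v w : 'rV[R]_(m + m) :=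
  (1 + dot z z) ^- 2 * (2 * dot d z) *:
    (dot v z *: w + dot v (imul z) *: imul w
     + (dot w z *: v + dot w (imul z) *: imul v))
  - (1 + dot z z)^-1 *:
    (dot v d *: w + dot v (imul d) *: imul w
     + (dot w d *: v + dot w (imul d) *: imul v)).

(** The curvature tensor [R(v, w) x] of a complex space form of constant holomorphic sectional
    curvature 4. *)
Definition fs_curv z v w x : 'rV[R]_(m + m) :=
  (2 * fs z v (imul w)) *: imul x - fs z x v *: w - fs z x (imul v) *: imul w
  + fs z x w *: v + fs z x (imul w) *: imul v.

(** The left-hand side is the coordinate formula for curvature: the derivative of the Christoffel
    map plus its quadratic term, antisymmetrized in [v] and [w]. *)
Lemma fs_curvE z v w x :
  fs_dgamma z v w x + fs_gamma z v (fs_gamma z w x)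
  - (fs_dgamma z w v x + fs_gamma z w (fs_gamma z v x)) = fs_curv z v w x.
Proof.
rewrite /fs_curv /fs_dgamma /fs_gamma !fsE.
rewrite !(dotDl, dotDr, dotZl, dotZr, imulD, imulZ, imulN, imul_imul).
rewrite !(dot_imull, dotNl, dotNr, imul_imul).
rewrite (dotC w v) !(dotC x) (dotC w (imul v)).
rewrite !(dot_imull, dotNl, dotNr, imul_imul).
apply/rowP => j; rewrite !mxE.
field; exact: rho_neq0.
Qed.

(** Only the curvature term along [imul x] survives. With [x] the unit normal and [v], [w]
    horizontal, it is the source of the term [2 phi] in the Codazzi equation. *)
Lemma fs_curv_normal z v w x :
  fs z x x = 1 -> fs z v x = 0 -> fs z w x = 0 -> fs z (imul v) x = 0 ->
  fs z (imul w) x = 0 -> fs z (imul x) (fs_curv z v w x) = 2 * fs z v (imul w).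
Proof.
move=> xx vx wx Jvx Jwx; rewrite /fs_curv !(fsDr, fsNr, fsZr) fs_imul.
by rewrite !(fsC z x) xx vx wx Jvx Jwx; ring.
Qed.

Lemma is_derive_fs_gamma (V : normedModType R) (x v : V)
    (h P Q : V -> 'rV[R]_(m + m)) dh dP dQ :
  is_derive x v h dh -> is_derive x v P dP -> is_derive x v Q dQ ->
  is_derive x v (fun y => fs_gamma (h y) (P y) (Q y))
    (fs_gamma (h x) dP (Q x) + fs_gamma (h x) (P x) dQ
     + fs_dgamma (h x) dh (P x) (Q x)).
Proof.
move=> hh hP hQ; rewrite /fs_gamma.
have hr := is_derive_rhoV hh.
have hJ := is_derive_imul hh.
have hS (A B : V -> 'rV[R]_(m + m)) dA dB (hA : is_derive x v A dA)
    (hB : is_derive x v B dB) := is_deriveD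
  (is_derive_scale (is_derive_dot hA hh) hB)
  (is_derive_scale (is_derive_dot hA hJ) (is_derive_imul hB)).
have H := is_derive_scale (is_deriveN hr)
  (is_deriveD (hS _ _ _ _ hP hQ) (hS _ _ _ _ hQ hP)).
apply: is_derive_eq H _; rewrite /fs_dgamma.
set r := (1 + _)^-1; set s := _ ^- 2.
by apply/rowP => j; rewrite !mxE !fctE -/r; ring.
Qed.

End Curvature.

(** * Covariant derivatives of vector fields along a map *)

HB.lock Definition nabla (R : realType) (m n : nat)
    (h W : 'rV[R]_n -> 'rV[R]_(m + m)) (u v : 'rV[R]_n) : 'rV[R]_(m + m) :=
  'D_v W u + fs_gamma (h u) ('D_v h u) (W u).
Arguments nabla {R m n} h W u v.

Section CovariantDerivative.
Variables (R : realType) (m n : nat).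
Implicit Types (h W : 'rV[R]_n -> 'rV[R]_(m + m)) (u v w : 'rV[R]_n).

Lemma derive_swap_row p (F : 'rV[R]_n -> 'rV[R]_p) u v w :
  (\forall y \near u, differentiable F y) ->
  differentiable ('D_v F) u -> differentiable ('D_w F) u ->
  'D_w ('D_v F) u = 'D_v ('D_w F) u.
Proof.
move=> dF dvF dwF; apply/rowP => j.
have coord (G : 'rV[R]_n -> 'rV[R]_p) y : differentiable G y ->
    differentiable (fun y => G y 0 j) y.
  by move=> dG; exact: (differentiable_comp dG (differentiable_coord _ 0 j)).
have D (G : 'rV[R]_n -> 'rV[R]_p) y x : differentiable G y ->
    'D_x (fun y => G y 0 j) y = 'D_x G y 0 j.
  move=> dG; have := derivableP (diff_derivable (v := x) dG).
  by move/is_derive_rowP => /(_ j) [].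
have near_u : \forall y \near u, [/\ differentiable (fun y => F y 0 j) y,
    'D_v (fun y => F y 0 j) y = 'D_v F y 0 j &
    'D_w (fun y => F y 0 j) y = 'D_w F y 0 j].
  by apply: filterS dF => y dFy; split; [exact: coord|exact: D|exact: D].
have swap := derive_swap near_u (coord _ _ dvF) (coord _ _ dwF).
exact: etrans (esym (D _ u w dvF)) (etrans swap (D _ u v dwF)).
Qed.

Lemma nablaE h W u v :
  nabla h W u v = 'D_v W u + fs_gamma (h u) ('D_v h u) (W u).
Proof. by rewrite nabla.unlock. Qed.

Lemma covdE h W u v : covd (@fubini_study R m) h W u v = nabla h W u v.
Proof. by rewrite /covd christoffel_fs nablaE. Qed.

Lemma is_derive_fs_nabla h P Q u v :
  derivable h u v -> derivable P u v -> derivable Q u v ->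
  is_derive u v (fun y => fs (h y) (P y) (Q y))
    (fs (h u) (nabla h P u v) (Q u) + fs (h u) (P u) (nabla h Q u v)).
Proof.
move=> /derivableP hh /derivableP hP /derivableP hQ.
by rewrite !nablaE; exact: is_derive_fs.
Qed.

Lemma nabla_imul h W u v : derivable W u v ->
  nabla h (fun y => imul (W y)) u v = imul (nabla h W u v).
Proof.
move=> /derivableP /is_derive_imul DW.
by rewrite !nablaE (@derive_val _ _ _ _ _ _ _ DW) fs_gamma_imul -imulD.
Qed.

Lemma nabla_linear h W u a v b w : differentiable h u -> differentiable W u ->
  nabla h W u (a *: v + b *: w) = a *: nabla h W u v + b *: nabla h W u w.
Proof.
move=> dh dW.
have linD p (F : 'rV[R]_n -> 'rV[R]_p) : differentiable F u ->
    'D_(a *: v + b *: w) F u = a *: 'D_v F u + b *: 'D_w F u.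
  by move=> dF; rewrite !(deriveE _ dF) linearP linearZ.
rewrite !nablaE (linD _ _ dh) (linD _ _ dW) fs_gammaDl !fs_gammaZl.
have ac (c d e f : 'rV[R]_(m + m)) :
    a *: c + b *: d + (a *: e + b *: f) = a *: (c + e) + b *: (d + f).
  by rewrite !scalerDr addrACA.
exact: ac.
Qed.

Lemma is_derive_nabla h W u v w : derivable h u v -> derivable ('D_w h) u v ->
  derivable W u v -> derivable ('D_w W) u v ->
  is_derive u v (fun y => nabla h W y w)
    ('D_v ('D_w W) u + (fs_gamma (h u) ('D_v ('D_w h) u) (W u)
      + fs_gamma (h u) ('D_w h u) ('D_v W u)
      + fs_dgamma (h u) ('D_v h u) ('D_w h u) (W u))).
Proof.
move=> /derivableP hh /derivableP hwh /derivableP hW /derivableP hwW.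
rewrite (_ : (fun y => _) =
  'D_w W + (fun y => fs_gamma (h y) ('D_w h y) (W y))).
  exact: is_deriveD hwW (is_derive_fs_gamma hh hwh hW).
by apply/funext => y; rewrite nablaE.
Qed.

(** This is the curvature of the connection pulled back along [h]; the constant fields [v] and [w]
    commute, so there is no bracket term. *)
Lemma nabla_comm h W u v w :
  (\forall y \near u, differentiable h y) ->
  (\forall y \near u, differentiable W y) ->
  (forall x, differentiable ('D_x h) u) ->
  (forall x, differentiable ('D_x W) u) ->
  nabla h (fun y => nabla h W y w) u v - nabla h (fun y => nabla h W y v) u w
  = fs_curv (h u) ('D_v h u) ('D_w h u) (W u).
Proof.
move=> hn Wn dh dW; have hu := nbhs_singleton hn; have Wu := nbhs_singleton Wn.
have D x y : 'D_x (fun z => nabla h W z y) u = _ := @derive_val _ _ _ _ _ _ _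
  (@is_derive_nabla h W u x y (diff_derivable hu) (diff_derivable (dh y))
     (diff_derivable Wu) (diff_derivable (dW y))).
have gDr z a b c : fs_gamma z a (b + c) = fs_gamma z a b + fs_gamma z a c.
  by rewrite fs_gammaC fs_gammaDl !(fs_gammaC z a).
have nabla2 x y : nabla h (fun z => nabla h W z y) u x =
    'D_x ('D_y W) u + (fs_gamma (h u) ('D_x ('D_y h) u) (W u)
      + fs_gamma (h u) ('D_y h u) ('D_x W u)
      + fs_dgamma (h u) ('D_x h u) ('D_y h u) (W u))
    + (fs_gamma (h u) ('D_x h u) ('D_y W u)
       + fs_gamma (h u) ('D_x h u) (fs_gamma (h u) ('D_y h u) (W u))).
  rewrite nablaE (nablaE h W u y); congr (_ + _); [exact: D|exact: gDr].
(* The mixed second derivatives of [W] and of [h] cancel by symmetry, and the cross terms [c] and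
   [e] occur on both sides; the curvature expression remains. *)
have ac (a a' b b' c d d' e f f' : 'rV[R]_(m + m)) : a = a' -> b = b' ->
    a + (b + c + d) + (e + f) - (a' + (b' + e + d') + (c + f')) =
    d + f - (d' + f').
  by move=> -> ->; apply/rowP => j; rewrite !mxE; ring.
rewrite (nabla2 v w) (nabla2 w v) -fs_curvE.
apply: ac; first exact: derive_swap_row Wn (dW w) (dW v).
exact: (congr1 (fun X => fs_gamma (h u) X (W u))
  (derive_swap_row hn (dh w) (dh v))).
Qed.

End CovariantDerivative.

(** The conditions are linear and their matrix has rank at most [p], so its left kernel is
    nonzero. *)
Lemma exists_fs_orthogonal (R : realType) (m : nat) (z : 'rV[R]_(m + m))
    (p : nat) (c : 'I_p -> 'rV[R]_(m + m)) : (p < m + m)%N ->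
  exists2 x, x != 0 & forall j, fs z x (c j) = 0.
Proof.
move=> pm; pose M := \matrix_(i, j) fs z (delta_mx 0 i) (c j).
have : kermx M != 0.
  rewrite -mxrank_eq0 mxrank_ker subn_eq0 -ltnNge.
  exact: leq_ltn_trans (rank_leq_col M) pm.
move=> /negPf kM0; exists (nz_row (kermx M)); first by rewrite nz_row_eq0 kM0.
move=> j; have : nz_row (kermx M) *m M = 0.
  by apply/eqP; rewrite -sub_kermx nz_row_sub.
move=> /rowP /(_ j); rewrite mxE [in RHS]mxE => <-.
by rewrite fs_suml; apply: eq_bigr => i _; rewrite [M _ _]mxE.
Qed.

(** * Algebra of the purity condition at a point *)

Section PointwiseAlgebra.
Variables (R : realType) (m : nat) (k : R) (z N : 'rV[R]_(m + m)).
Variable A : 'rV[R]_(m + m) -> 'rV[R]_(m + m).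
Let xi := - imul N.

Hypothesis N_unit : fs z N N = 1.
Hypothesis A_tangent : forall X, fs z (A X) N = 0.
Hypothesis A_sym : forall X Y, fs z X N = 0 -> fs z Y N = 0 ->
  fs z (A X) Y = fs z X (A Y).

(** The holomorphic distribution, described by the metric and the normal alone, so that the
    pointwise algebra involves no immersion. *)
Definition horizontal X := fs z X N = 0 /\ fs z X (imul N) = 0.

(* The [Z]-component of [A_T (phi X) Y = A_T X (phi Y)]. *)
Hypothesis pure : forall X Y Z, horizontal X -> horizontal Y -> fs z Z N = 0 ->
  fs z (imul (A (imul X)) - A X) (A Y) * fs z xi Z
  - fs z (A Y) xi * (fs z (imul (A (imul X))) Z + k * fs z X Z)
  - fs z (imul (A (imul X)) - A X) Y * fs z (A xi) Z =
  fs z (imul (A X) + A (imul X)) (A (imul Y)) * fs z xi Z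
  - fs z (A (imul Y)) xi * (fs z (imul (A X)) Z - k * fs z (imul X) Z)
  - fs z (imul (A X) + A (imul X)) (imul Y) * fs z (A xi) Z.

Lemma xi_tangent : fs z xi N = 0.
Proof. by rewrite /xi fsNl fs_imull fs_imulid opprK. Qed.

Lemma horizontal_imul X : horizontal X -> horizontal (imul X).
Proof.
by case=> h1 h2; split; rewrite ?fs_imul // fs_imull h2 oppr0.
Qed.

Lemma fs_xi_xi : fs z xi xi = 1.
Proof. by rewrite /xi fsNl fsNr opprK fs_imul. Qed.

(* The bound on [m] provides a horizontal [x] orthogonal to both [b] and
   [imul b]. *)
Lemma xi_principal (hm : (3 <= m)%N) (hk : k != 0) X :
  horizontal X -> fs z (A xi) X = 0.
Proof.
pose b := A xi - fs z (A xi) xi *: xi.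
have bN : fs z b N = 0.
  by rewrite fsDl fsNl fsZl A_tangent xi_tangent mulr0 subr0.
have bxi : fs z b xi = 0.
  by rewrite fsDl fsNl fsZl fs_xi_xi mulr1 subrr.
have hb : horizontal b.
  by split=> //; rewrite -[imul N]opprK fsNr -/xi bxi oppr0.
have horiz_xi Y : horizontal Y -> fs z xi Y = 0.
  by case=> _ h; rewrite /xi fsNl fsC h oppr0.
have AxiE Y : horizontal Y -> fs z (A xi) Y = fs z b Y.
  by move=> hY; rewrite /b fsDl fsNl fsZl horiz_xi // mulr0 subr0.
have thE Y : horizontal Y -> fs z (A Y) xi = fs z b Y.
  move=> hY; rewrite (A_sym hY.1 xi_tangent).
  exact: etrans (fsC _ _ _) (AxiE _ hY).
suff b0 : b = 0 by move=> hX; rewrite AxiE // b0 fs0l.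
apply: (@fs_eq0 _ _ z); apply/eqP/negPn/negP => bb0.
have m4 : (4 < m + m)%N by rewrite (leq_trans _ (leq_add hm hm)).
have [x x0 hx] := @exists_fs_orthogonal R m z 4
  (fun j => tnth [tuple N; imul N; b; imul b] j) m4.
have xN : fs z x N = 0 := hx (Ordinal (isT : 0 < 4)%N).
have xJN : fs z x (imul N) = 0 := hx (Ordinal (isT : 1 < 4)%N).
have xb : fs z x b = 0 := hx (Ordinal (isT : 2 < 4)%N).
have xJb : fs z x (imul b) = 0 := hx (Ordinal (isT : 3 < 4)%N).
have hX : horizontal x by [].
have hJX := horizontal_imul hX; have hJb := horizontal_imul hb.
have hJJX := horizontal_imul hJX; have hJJb := horizontal_imul hJb.
have bx : fs z b x = 0 by rewrite fsC.
have bJx : fs z b (imul x) = 0 by rewrite fsC fs_imull xJb oppr0.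
have bJb : fs z b (imul b) = 0 by rewrite fs_imulid.
have xx0 : 0 < fs z x x.
  by rewrite lt0r fs_ge0 andbT; apply: contra_neq x0 => /fs_eq0.
(* With [p] and [q] as set below, [Y = x], [Z = b] gives [p + q = 0]; [Y = b], [Z = x] gives
   [q = k |x|^2]; [Y = imul b], [Z = imul x] gives [p = k |x|^2]. *)
have := pure hX hX bN; have := pure hX hb xN; have := pure hX hJb hJX.1.
rewrite !thE // !AxiE // !(horiz_xi _ hX) !(horiz_xi _ hb) !(horiz_xi _ hJX).
rewrite !imul_imul bx bJx bJb.
rewrite !(mulr0, mul0r, subr0, sub0r, add0r).
rewrite fsNr; set B := fs z b b in bb0 *.
rewrite !(fsDl, fsNl, fsNr, fs_imul, fs_imull _ (A (imul x))) oppr0 !sub0r.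
set p := fs z (A x) x; set q := fs z (A (imul x)) (imul x).
move=> /esym/eqP; rewrite mulNr opprK mulf_eq0 (negPf bb0) /=.
rewrite subr_eq0 => /eqP Ep.
move=> /eqP; rewrite oppr_eq0 mulf_eq0 (negPf bb0) /= => /eqP Eq.
move=> /eqP; rewrite eqr_opp -subr_eq0 -mulrBl mulf_eq0 (negPf bb0) orbF.
move=> /eqP Epq; have : k * fs z x x = 0 by lra.
by move/eqP; rewrite mulf_eq0 (negPf hk) (gt_eqF xx0).
Qed.

(* The hypotheses add up to [|A X + phi (A (phi X))|^2 = -4 |X|^2]. *)
Lemma hopf_absurd X : X != 0 -> horizontal X ->
  (forall Y, horizontal Y -> fs z (A xi) Y = 0) ->
  2 * fs z (imul (A X)) (A (imul X)) - 2 * fs z X X =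
    fs z (A xi) xi * (fs z X (A X) + fs z (imul X) (A (imul X))) -> False.
Proof.
move=> X0 hX hopf E.
have hJX := horizontal_imul hX.
have th Y : horizontal Y -> fs z (A Y) xi = 0.
  move=> hY; rewrite (A_sym hY.1 xi_tangent).
  exact: etrans (fsC _ _ _) (hopf _ hY).
(* Put [s = g (J A X) (A J X)]. This instance reads [|A X|^2 + |A J X|^2 + 2 s = 2 r], where [r] is
   the right-hand side of [E]. Eliminating [r] leaves [|A X|^2 + |A J X|^2 - 2 s = -4 |X|^2], whose
   left-hand side is [|A X + J A J X|^2]. *)
have := pure hX hX xi_tangent.
rewrite fs_xi_xi (th _ hX) (th _ hJX).
have := fs_ge0 z (A X + imul (A (imul X))).
have : 0 < fs z X X.
  by rewrite lt0r fs_ge0 andbT; apply: contra_neq X0 => /fs_eq0.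
rewrite !(fsDl, fsDr, fsNl, fs_imul, imul_imul, mulr1, mul0r, subr0).
rewrite (fs_imull z (A X)) (fs_imull z _ X) (fsC z (imul (A _)) (A X)).
rewrite -opprD mulNr opprK (addrC (fs z (A (imul X)) _)).
move: E; rewrite (fs_imull z (A X)) (fsC z X (A X)) (fsC z (imul X)).
by rewrite (mulrC (fs z (A xi) xi)); move: (_ * fs z (A xi) xi) => t; lra.
Qed.


End PointwiseAlgebra.

(** * Local geometry of the hypersurface *)

HB.lock Definition weingarten (R : realType) (m : nat)
    (h N : 'rV[R]_((m + m).-1) -> 'rV[R]_(m + m)) (u : 'rV[R]_((m + m).-1))
    (X : 'rV[R]_(m + m)) : 'rV[R]_(m + m) := Defs.shape h N u X.
Arguments weingarten {R m} h N u X.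

Section LocalHypersurface.
Variables (R : realType) (m : nat).
Variables (h N : 'rV[R]_((m + m).-1) -> 'rV[R]_(m + m)).
Variable U : set 'rV[R]_((m + m).-1).
Implicit Types (u v w : 'rV[R]_((m + m).-1)) (X Y : 'rV[R]_(m + m)).
Hypotheses (U_open : open U) (h_smooth : smooth_on U h).
Hypothesis h_immersion : forall u, U u -> row_free ('J h u).
Hypothesis N_normal : unit_normal_on h N U.

Let N_smooth : smooth_on U N := N_normal.1.

Let near_U u : U u -> \forall y \near u, U y.
Proof. by move=> Uu; apply: open_nbhs_nbhs. Qed.

Let diff_h u : U u -> differentiable h u := h_smooth [::] (u := u).
Let diff_N u : U u -> differentiable N u := N_smooth [::] (u := u).
Let diff_Dh w u : U u -> differentiable ('D_w h) u := h_smooth [:: w] (u := u).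
Let diff_DN w u : U u -> differentiable ('D_w N) u := N_smooth [:: w] (u := u).

Lemma derive_jacobian u v : U u -> 'D_v h u = v *m 'J h u.
Proof. by move=> Uu; rewrite deriveEjacobian //; exact: diff_h. Qed.

Lemma fs_normal u : U u -> fs (h u) (N u) (N u) = 1.
Proof. by move=> Uu; have [] := N_normal.2 u Uu; rewrite fs.unlock. Qed.

Lemma fs_derive_normal u v : U u -> fs (h u) ('D_v h u) (N u) = 0.
Proof.
move=> Uu; rewrite derive_jacobian // fs.unlock.
by apply: (N_normal.2 u Uu).2; rewrite /tangent submxMl.
Qed.

(** The form [g(., N)] is given by a nonzero column [c], so its kernel has dimension [2m - 1]. It
    contains the image of the differential, which has the same dimension because [h] is an
    immersion. *)
Lemma tangentP u X : U u -> tangent h u X <-> fs (h u) X (N u) = 0.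
Proof.
move=> Uu; split=> [|XN].
  by rewrite fs.unlock; apply: (N_normal.2 u Uu).2.
pose c := gram (@fubini_study R m) (h u) *m (N u)^T.
have mulc Y : (Y *m c) 0 0 = fs (h u) Y (N u).
  rewrite mulmxA mxE fsC fs_suml; apply: eq_bigr => j _.
  by rewrite mul_gramE mxE fsC mulrC.
have c0 : \rank c = 1.
  apply/eqP; rewrite eqn_leq rank_leq_col lt0n mxrank_eq0; apply/eqP => c0.
  by have := mulc (N u); rewrite c0 mulmx0 mxE fs_normal // => /eqP;
    rewrite eq_sym oner_eq0.
have Jc : ('J h u <= kermx c)%MS.
  apply/sub_kermxP/row_matrixP => i; rewrite row_mul rowE row0.
  apply/rowP => j; rewrite (ord1 j) mulc -derive_jacobian //.
  rewrite fs_derive_normal //.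
  by rewrite mxE.
have : (kermx c <= 'J h u)%MS.
  rewrite -(geq_leqif (mxrank_leqif_sup Jc)) mxrank_ker c0 subn1.
  by rewrite (eqP (h_immersion Uu)).
apply: submx_trans; apply/sub_kermxP/rowP => j.
by rewrite (ord1 j) mulc XN mxE.
Qed.

Lemma weingartenE u X :
  weingarten h N u X = - nabla h N u (X *m pinvmx ('J h u)).
Proof. by rewrite weingarten.unlock /Defs.shape covdE. Qed.

(** The Jacobian is row free, so [pinvmx] recovers [v] from its image. *)
Lemma weingarten_derive u v : U u ->
  weingarten h N u ('D_v h u) = - nabla h N u v.
Proof.
move=> Uu; rewrite weingartenE (derive_jacobian v Uu).
by rewrite (mulmxKp (h_immersion Uu)).
Qed.

Lemma weingarten_linear u a X b Y : U u ->
  weingarten h N u (a *: X + b *: Y) =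
  a *: weingarten h N u X + b *: weingarten h N u Y.
Proof.
move=> Uu; rewrite !weingartenE mulmxDl -!scalemxAl.
rewrite (nabla_linear _ _ _ _ (diff_h Uu) (diff_N Uu)).
by rewrite opprD !scalerN.
Qed.

Lemma weingarten_scale u a X : U u ->
  weingarten h N u (a *: X) = a *: weingarten h N u X.
Proof.
move=> Uu; have := weingarten_linear a X 0 0 Uu.
by rewrite !scale0r !addr0.
Qed.

Lemma tangent_derive u X : U u -> fs (h u) X (N u) = 0 ->
  exists v, X = 'D_v h u.
Proof.
move=> Uu /(tangentP _ Uu) XJ; exists (X *m pinvmx ('J h u)).
by rewrite derive_jacobian // mulmxKpV.
Qed.

Lemma fs_nabla_normal u v : U u -> fs (h u) (nabla h N u v) (N u) = 0.
Proof.
move=> Uu; have dN := diff_derivable (v := v) (diff_N Uu).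
have D := is_derive_fs_nabla (diff_derivable (diff_h Uu)) dN dN.
have N1 : \forall y \near u, fs (h y) (N y) (N y) = 1.
  by apply: filterS (near_U Uu) => y /fs_normal.
have := is_derive_near_cst D N1.
by rewrite (fsC _ (N u)); move: (fs _ _ _) => t; lra.
Qed.

Lemma fs_weingarten_normal u X : U u -> fs (h u) (weingarten h N u X) (N u) = 0.
Proof. by move=> Uu; rewrite weingartenE fsNl fs_nabla_normal // oppr0. Qed.

(** Absence of torsion: second derivatives of [h] commute and [fs_gamma] is symmetric. *)
Lemma nabla_derive_sym u v w : U u ->
  nabla h ('D_w h) u v = nabla h ('D_v h) u w.
Proof.
move=> Uu; have dh : \forall y \near u, differentiable h y.
  by apply: filterS (near_U Uu) => y; exact: diff_h.
rewrite (nablaE h ('D_w h) u v) (nablaE h ('D_v h) u w).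
exact: (f_equal2 (fun a b : 'rV[R]_(m + m) => a + b)
  (derive_swap_row dh (diff_Dh w Uu) (diff_Dh v Uu)) (fs_gammaC _ _ _)).
Qed.

(** Obtained by differentiating [g(N, dh(w)) = 0]. It relates the shape operator to the second
    fundamental form, from which it inherits symmetry. *)
Lemma fs_nabla_derive u v w : U u ->
  fs (h u) (nabla h N u v) ('D_w h u) = - fs (h u) (N u) (nabla h ('D_w h) u v).
Proof.
move=> Uu; have dh := diff_derivable (v := v) (diff_h Uu).
have dN := diff_derivable (v := v) (diff_N Uu).
have dDh := diff_derivable (v := v) (diff_Dh w Uu).
have D := is_derive_fs_nabla dh dN dDh.
have D0 : \forall y \near u, fs (h y) (N y) ('D_w h y) = 0.
  by apply: filterS (near_U Uu) => y Uy; rewrite fsC fs_derive_normal.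
by have := is_derive_near_cst D D0; move: (fs _ _ _) (fs _ _ _) => a b; lra.
Qed.

Lemma weingarten_sym u X Y : U u ->
  fs (h u) X (N u) = 0 -> fs (h u) Y (N u) = 0 ->
  fs (h u) (weingarten h N u X) Y = fs (h u) X (weingarten h N u Y).
Proof.
move=> Uu /tangent_derive[//|v ->] /tangent_derive[//|w ->].
rewrite !weingarten_derive // fsNl fsNr (fsC _ ('D_v h u)) !fs_nabla_derive //.
by rewrite (nabla_derive_sym v w).
Qed.

(* With [X = 'D_w h u], these are [g (A xi) X] and [g X xi]. *)
Definition theta w u := fs (h u) (imul (N u)) (nabla h N u w).
Definition contact w u := fs (h u) (imul ('D_w h u)) (N u).

Lemma is_derive_theta u v w : U u ->
  is_derive u v (theta w) (fs (h u) (imul (nabla h N u v)) (nabla h N u w)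
    + fs (h u) (imul (N u)) (nabla h (fun y => nabla h N y w) u v)).
Proof.
move=> Uu; have dh := diff_derivable (v := v) (diff_h Uu).
have dN := diff_derivable (v := v) (diff_N Uu).
have dDh := diff_derivable (v := v) (diff_Dh w Uu).
have dDN := diff_derivable (v := v) (diff_DN w Uu).
have [dn _] := is_derive_nabla dh dDh dN dDN.
have [dJ _] := is_derive_imul (derivableP dN).
by rewrite -(nabla_imul h dN); exact: is_derive_fs_nabla dh dJ dn.
Qed.

Lemma is_derive_contact u v w : U u ->
  is_derive u v (contact w) (fs (h u) (imul (nabla h ('D_w h) u v)) (N u)
    + fs (h u) (imul ('D_w h u)) (nabla h N u v)).
Proof.
move=> Uu; have dh := diff_derivable (v := v) (diff_h Uu).
have dN := diff_derivable (v := v) (diff_N Uu).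
have dDh := diff_derivable (v := v) (diff_Dh w Uu).
have [dJ _] := is_derive_imul (derivableP dDh).
by rewrite -(nabla_imul h dDh); exact: is_derive_fs_nabla dh dJ dN.
Qed.

Lemma contactE w u : contact w u = - fs (h u) ('D_w h u) (imul (N u)).
Proof. by rewrite /contact fs_imull. Qed.

Lemma theta_linear a v b w u : U u ->
  theta (a *: v + b *: w) u = a * theta v u + b * theta w u.
Proof.
move=> Uu; rewrite /theta (nabla_linear a v b w (diff_h Uu) (diff_N Uu)).
by rewrite fsDr !fsZr.
Qed.

Lemma contact_linear a v b w u : U u ->
  contact (a *: v + b *: w) u = a * contact v u + b * contact w u.
Proof.
move=> Uu; rewrite /contact !derive_jacobian // mulmxDl -!scalemxAl.
by rewrite imulD !imulZ fsDl !fsZl.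
Qed.

(** Antisymmetrizing turns the second covariant derivatives of [N] into curvature, which
    [fs_curv_normal] evaluates on horizontal vectors. *)
Lemma dtheta u v w : U u -> contact v u = 0 -> contact w u = 0 ->
  'D_v (theta w) u - 'D_w (theta v) u =
    2 * fs (h u) (imul (nabla h N u v)) (nabla h N u w)
    + 2 * fs (h u) ('D_v h u) (imul ('D_w h u)).
Proof.
move=> Uu cv cw; have [_ ->] := is_derive_theta v w Uu.
have [_ ->] := is_derive_theta w v Uu.
have nbr : nabla h (fun y => nabla h N y w) u v =
    nabla h (fun y => nabla h N y v) u w
    + fs_curv (h u) ('D_v h u) ('D_w h u) (N u).
  apply/eqP; rewrite addrC -subr_eq; apply/eqP; apply: nabla_comm => [||x|x].
  - by apply: filterS (near_U Uu) => y; exact: diff_h.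
  - by apply: filterS (near_U Uu) => y; exact: diff_N.
  - exact: diff_Dh.
  - exact: diff_DN.
rewrite nbr fsDr fs_curv_normal ?fs_normal ?fs_derive_normal //; clear nbr.
move: ('D_v h u) ('D_w h u) => X Y.
by rewrite (fs_imull _ (nabla h N u w)) (fsC _ (nabla h N u w)); ring.
Qed.

(** The second covariant derivatives of [h] cancel because they are symmetric. *)
Lemma dcontact u v w : U u ->
  'D_v (contact w) u - 'D_w (contact v) u =
    fs (h u) (imul ('D_w h u)) (nabla h N u v)
    - fs (h u) (imul ('D_v h u)) (nabla h N u w).
Proof.
move=> Uu; have [_ ->] := is_derive_contact v w Uu.
have [_ ->] := is_derive_contact w v Uu.
by rewrite (nabla_derive_sym v w) //; ring.
Qed.

(* If [xi] is principal near [u], then [theta] is a multiple of the contact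
   form; comparing their exterior derivatives on horizontal vectors avoids
   differentiating the principal curvature. *)
Lemma dtheta_hopf u v w w0 :
  (forall y x, U y -> contact x y = 0 -> theta x y = 0) ->
  U u -> contact w0 u = 1 -> contact v u = 0 -> contact w u = 0 ->
  'D_v (theta w) u - 'D_w (theta v) u =
    theta w0 u * ('D_v (contact w) u - 'D_w (contact v) u).
Proof.
move=> hopf Uu c0 cv cw.
have prop y x : U y -> theta x y * contact w0 y = theta w0 y * contact x y.
  (* This combination of [x] and [w0] is annihilated by the contact form, hence by [theta]. *)
  move=> Uy; have := hopf y (contact w0 y *: x + (- contact x y) *: w0) Uy.
  rewrite (contact_linear _ x _ w0 Uy) (theta_linear _ x _ w0 Uy).
  move: (contact w0 y) (contact x y) (theta x y) (theta w0 y) => a b c d H.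
  have /H : a * b + - b * a = 0 by ring.
  by move=> E; apply/eqP; rewrite -subr_eq0 -E; apply/eqP; ring.
have D x a : contact x u = 0 ->
    'D_a (theta x) u = theta w0 u * 'D_a (contact x) u.
  move=> cx; rewrite -[LHS]mulr1 -c0.
  have near_prop : \forall y \near u,
      theta x y * contact w0 y = theta w0 y * contact x y.
    by apply: filterS (near_U Uu) => y; exact: prop.
  have [dtx _] := is_derive_theta a x Uu.
  have [dcx _] := is_derive_contact a x Uu.
  exact: derive_proportional (derivableP dtx) (derivableP dcx)
    (is_derive_theta a w0 Uu) (is_derive_contact a w0 Uu) near_prop
    (hopf _ _ Uu cx) cx.
by rewrite (D w v cw) (D v w cv) mulrBr.
Qed.

(** The Codazzi equation paired with [X] and [imul X]: the two expressions for the exterior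
    derivative of [theta] on this pair are equated. *)
Lemma hopf_curvature u X :
  (forall y x, U y -> contact x y = 0 -> theta x y = 0) -> U u ->
  horizontal (h u) (N u) X ->
  let A := weingarten h N u in let g := fs (h u) in let xi := - imul (N u) in
  2 * g (imul (A X)) (A (imul X)) - 2 * g X X =
    g (A xi) xi * (g X (A X) + g (imul X) (A (imul X))).
Proof.
move=> hopf Uu hX A g xi.
have hJX := horizontal_imul hX.
have [v Xv] := tangent_derive Uu hX.1.
have [w JXw] := tangent_derive Uu hJX.1.
(* As [w0] represents [xi], the value [theta w0 u] is the principal curvature [g (A xi) xi]. *)
have [w0 xiw0] := tangent_derive Uu (xi_tangent (h u) (N u)).
have cv : contact v u = 0 by rewrite contactE -Xv hX.2 oppr0.
have cw : contact w u = 0 by rewrite contactE -JXw hJX.2 oppr0.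
have c0 : contact w0 u = 1.
  by rewrite contactE -xiw0 fsNl opprK fs_imul fs_normal.
have := dtheta_hopf hopf Uu c0 cv cw.
have nA x : nabla h N u x = - A ('D_x h u).
  by rewrite /A weingarten_derive // opprK.
rewrite (dtheta Uu cv cw) (dcontact v w Uu) /theta !nA -Xv -JXw -xiw0.
rewrite /g -/xi; move: (A xi) (A X) (A (imul X)) => c a b; clear.
rewrite imul_imul !imulN !fsNr !fsNl !opprK mulrN.
by rewrite (fsC _ (imul (N u)) c) => ->.
Qed.

(** * The purity condition expressed through [imul] and the shape operator *)

Section Purity.
Variables (k : R) (u : 'rV[R]_((m + m).-1)) (Uu : U u).

Let A := weingarten h N u.
Let zeta := - imul (N u).

Lemma phiE X : phi h N u X = imul X - fs (h u) (imul X) (N u) *: N u.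
Proof. by rewrite /phi fs.unlock imul.unlock. Qed.

Lemma xiE : xi N u = zeta.
Proof. by rewrite /xi /zeta imul.unlock. Qed.

Lemma etaE X : Defs.eta h N u X = fs (h u) X zeta.
Proof. by rewrite /Defs.eta xiE fs.unlock. Qed.

Lemma max_holomorphicP X : max_holomorphic h N u X <-> horizontal (h u) (N u) X.
Proof.
rewrite /max_holomorphic -/(Defs.eta h N u X) etaE /zeta fsNr.
split=> -[/(tangentP _ Uu) h1 h2].
  by split=> //; rewrite -[LHS]opprK h2 oppr0.
by split; [exact: h1|rewrite h2 oppr0].
Qed.

Lemma phi_horizontal X : horizontal (h u) (N u) X -> phi h N u X = imul X.
Proof.
by move=> /horizontal_imul[hX _]; rewrite phiE hX scale0r subr0.
Qed.

Lemma fs_phi X Z : fs (h u) Z (N u) = 0 ->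
  fs (h u) (phi h N u X) Z = fs (h u) (imul X) Z.
Proof.
by move=> ZN; rewrite phiE fsDl fsNl fsZl (fsC _ (N u)) ZN mulr0 subr0.
Qed.

Lemma choE X Y : cho k h N u X Y = fs (h u) (phi h N u (A X)) Y *: zeta
  - fs (h u) Y zeta *: phi h N u (A X) - (k * fs (h u) X zeta) *: phi h N u Y.
Proof. by rewrite /cho !etaE xiE fs.unlock /A weingarten.unlock. Qed.

Lemma horizontal_zeta X : horizontal (h u) (N u) X -> fs (h u) X zeta = 0.
Proof. by case=> _ h2; rewrite /zeta fsNr h2 oppr0. Qed.

Lemma cho_horizontal_l X Z : horizontal (h u) (N u) X ->
  fs (h u) Z (N u) = 0 ->
  cho k h N u X Z = fs (h u) (imul (A X)) Z *: zeta
    - fs (h u) Z zeta *: phi h N u (A X).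
Proof.
move=> hX ZN; rewrite choE (fs_phi (A X) ZN) (horizontal_zeta hX).
by rewrite mulr0 scale0r subr0.
Qed.

(** Symmetry of [A] moves it from [Z] to [imul X], so that the torsion operator of [X] is written
    with [A X] and [A (imul X)] only. *)
Lemma cho_horizontal_r X Z : horizontal (h u) (N u) X ->
  fs (h u) Z (N u) = 0 ->
  cho k h N u Z X = - fs (h u) (A (imul X)) Z *: zeta
    - (k * fs (h u) Z zeta) *: imul X.
Proof.
move=> hX ZN; have hJX := horizontal_imul hX.
rewrite choE (fs_phi (A Z) hX.1) (horizontal_zeta hX) (phi_horizontal hX).
rewrite scale0r subr0 fs_imull (fsC _ (A Z)) -(weingarten_sym Uu hJX.1 ZN).
by [].
Qed.

Lemma torsionE X Z : horizontal (h u) (N u) X -> fs (h u) Z (N u) = 0 ->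
  torsion k h N u X Z = fs (h u) (imul (A X) + A (imul X)) Z *: zeta
    - fs (h u) Z zeta *: (phi h N u (A X) - k *: imul X).
Proof.
move=> hX ZN; rewrite /torsion.
rewrite (cho_horizontal_l hX ZN) (cho_horizontal_r hX ZN).
rewrite fsDl; move: (phi h N u (A X)) (fs (h u) Z zeta) => p a.
move: (fs _ _ _) (fs _ _ _) => b c.
by apply/rowP => j; rewrite !mxE; ring.
Qed.

(** For horizontal [Y] the vector [torsion X Y] is a multiple of [xi], so [A] acts on it only
    through [A xi]; pairing with a tangent [Z] replaces [phi] by [imul]. *)
Lemma shape_torsionE X Y Z : horizontal (h u) (N u) X ->
  horizontal (h u) (N u) Y -> fs (h u) Z (N u) = 0 ->
  fs (h u) (shape_torsion k h N u X Y) Z =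
    fs (h u) (imul (A X) + A (imul X)) (A Y) * fs (h u) zeta Z
    - fs (h u) (A Y) zeta * (fs (h u) (imul (A X)) Z - k * fs (h u) (imul X) Z)
    - fs (h u) (imul (A X) + A (imul X)) Y * fs (h u) (A zeta) Z.
Proof.
move=> hX hY ZN; have -> : shape_torsion k h N u X Y =
    torsion k h N u X (A Y) - A (torsion k h N u X Y).
  by rewrite /A weingarten.unlock.
rewrite (torsionE hX (fs_weingarten_normal Y Uu)) (torsionE hX hY.1).
rewrite (horizontal_zeta hY) scale0r subr0 -/A.
have -> : A (fs (h u) (imul (A X) + A (imul X)) Y *: zeta) =
    fs (h u) (imul (A X) + A (imul X)) Y *: A zeta.
  exact: weingarten_scale.
rewrite -(fs_phi (A X) ZN).
move: (imul (A X) + A (imul X)) (A zeta) (phi h N u (A X)) => b c d.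
by rewrite !(fsDl, fsNl, fsZl).
Qed.

Hypothesis pure : forall X Y,
  max_holomorphic h N u X -> max_holomorphic h N u Y ->
  shape_torsion k h N u (phi h N u X) Y = shape_torsion k h N u X (phi h N u Y).

Lemma pure_components X Y Z : horizontal (h u) (N u) X ->
  horizontal (h u) (N u) Y -> fs (h u) Z (N u) = 0 ->
  fs (h u) (imul (A (imul X)) - A X) (A Y) * fs (h u) zeta Z
  - fs (h u) (A Y) zeta * (fs (h u) (imul (A (imul X))) Z + k * fs (h u) X Z)
  - fs (h u) (imul (A (imul X)) - A X) Y * fs (h u) (A zeta) Z =
  fs (h u) (imul (A X) + A (imul X)) (A (imul Y)) * fs (h u) zeta Z
  - fs (h u) (A (imul Y)) zeta
    * (fs (h u) (imul (A X)) Z - k * fs (h u) (imul X) Z)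
  - fs (h u) (imul (A X) + A (imul X)) (imul Y) * fs (h u) (A zeta) Z.
Proof.
move=> hX hY ZN; have hJX := horizontal_imul hX; have hJY := horizontal_imul hY.
rewrite -(shape_torsionE hX hJY ZN) -(phi_horizontal hY).
rewrite -pure; [|exact/max_holomorphicP|exact/max_holomorphicP].
rewrite (phi_horizontal hX) (shape_torsionE hJX hY ZN) imul_imul.
have -> : A (- X) = - A X.
  by rewrite -scaleN1r -[RHS]scaleN1r /A weingarten_scale.
by rewrite fsNl mulrN opprK.
Qed.

End Purity.

(** * Contradiction from purity on an open set *)

Lemma eta_pure_absurd (hm : (3 <= m)%N) (k : R) (hk : k != 0) u0 : U u0 ->
  (forall u, U u -> forall X Y,
    max_holomorphic h N u X -> max_holomorphic h N u Y ->
    shape_torsion k h N u (phi h N u X) Y =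
    shape_torsion k h N u X (phi h N u Y)) ->
  False.
Proof.
move=> Uu0 pure.
(* Purity is used here at all points of [U]: [theta] has to vanish on horizontal vectors throughout
   a neighbourhood before it can be differentiated. *)
have principal u X : U u -> horizontal (h u) (N u) X ->
    fs (h u) (weingarten h N u (- imul (N u))) X = 0.
  move=> Uu hX.
  have P X1 Y1 Z1 := @pure_components k u Uu (pure u Uu) X1 Y1 Z1.
  have N1 := fs_normal Uu.
  have AN X1 := fs_weingarten_normal X1 Uu.
  have As X1 Y1 := @weingarten_sym u X1 Y1 Uu.
  exact: (xi_principal N1 AN As P hm hk hX).
have hopf y x : U y -> contact x y = 0 -> theta x y = 0.
  move=> Uy; rewrite contactE => cx.
  have hX : horizontal (h y) (N y) ('D_x h y).
    by split; [exact: fs_derive_normal|rewrite -[LHS]opprK cx oppr0].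
  have := principal y _ Uy hX.
  rewrite (weingarten_sym Uy (xi_tangent _ _) (fs_derive_normal x Uy)).
  by rewrite (weingarten_derive x Uy) fsNl fsNr opprK.
have m2 : (2 < m + m)%N by rewrite (leq_trans _ (leq_add hm hm)).
have [X X0 hX] := @exists_fs_orthogonal R m (h u0) 2
  (fun j => tnth [tuple N u0; imul (N u0)] j) m2.
have HX : horizontal (h u0) (N u0) X.
  split; first exact: hX (Ordinal (isT : 0 < 2)%N).
  exact: hX (Ordinal (isT : 1 < 2)%N).
have P X1 Y1 Z1 := @pure_components k u0 Uu0 (pure u0 Uu0) X1 Y1 Z1.
have N1 := fs_normal Uu0.
have As X1 Y1 := @weingarten_sym u0 X1 Y1 Uu0.
exact: (hopf_absurd N1 As P X0 HX (fun Y => @principal u0 Y Uu0)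
  (hopf_curvature hopf Uu0 HX)).
Qed.

End LocalHypersurface.

Theorem theorem4 (R : realType) (m : nat) (hm : (3 <= m)%N) (k : R)
    (hk : k != 0) :
  ~ (exists M : real_hypersurface R m, eta_pure k M).
Proof.
(* The contradiction is local: it arises near any one point, in the chart and neighbourhood supplied
   by purity there. *)
move=> [M pureM]; have [x _] := hs_nonempty M.
have [c [i [V [N []]]]] := pureM x.
set h := local_map _ c i => -[cM _ V_open Vx VU] [N_normal pureV].
have h_smooth : smooth_on V h.
  by move=> s u /VU; exact: hs_smooth cM s u.
have h_immersion u : V u -> row_free ('J h u).
  by move=> /VU; exact: hs_immersion cM u.
exact: (@eta_pure_absurd R m h N V V_open h_smooth h_immersion N_normal hm k hk
  _ Vx pureV).
Qed.
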